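(* Let $q=p^n>2$, where $p$ is a prime and $n\ge1$ is an integer, and let $G=GL(2,q)$ be the general linear group of invertible $2\times2$ matrices over the field with $q$ elements. Then \[ M_1(\mathcal{C}(G))=q(q-1)(q^6-4q^5+4q^4+2q^3-4q^2+q-1), \] \[ M_2(\mathcal{C}(G))=\frac{q(q-1)}{2}(q^8-6q^7+14q^6-15q^5+3q^4+12q^3-16q^2+9q-1), \] \[ M_1(\mathcal{NC}(G))=(q-1)(q^{11}-2q^{10}-4q^9+9q^8+5q^7-15q^6+q^5+7q^4-2q^3+q^2-q), \] \[ M_2(\mathcal{NC}(G))=\frac{q(q-1)}{2}\big(q^{14}-3q^{13}-4q^{12}+19q^{11}-47q^9+28q^8+43q^7-50q^6+11q^5+4q^4-12q^3+19q^2-11q+2\big). \] Further, for $\Gamma(G)=\mathcal{C}(G)$ and for $\Gamma(G)=\mathcal{NC}(G)$, \[ \frac{M_2(\Gamma(G))}{|e(\Gamma(G))|}>\frac{M_1(\Gamma(G))}{|v(\Gamma(G))|}. \]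
   Context: For a finite simple undirected graph $\Gamma$ with vertex set $v(\Gamma)$ and edge set $e(\Gamma)$, the first and second Zagreb indices are $M_1(\Gamma)=\sum_{v\in v(\Gamma)}\deg(v)^2$ and $M_2(\Gamma)=\sum_{uv\in e(\Gamma)}\deg(u)\deg(v)$. For a finite non-abelian group $G$ with center $Z(G)$, the commuting graph $\mathcal{C}(G)$ is the simple graph with vertex set $G\setminus Z(G)$ in which two distinct vertices $x,y$ are adjacent iff $xy=yx$; the non-commuting graph $\mathcal{NC}(G)$ is the complement of $\mathcal{C}(G)$ (same vertex set, distinct $x,y$ adjacent iff $xy\ne yx$). *)

(* Defs.v *)
From HB Require Import structures.
From mathcomp Require Import all_boot all_order all_fingroup all_algebra all_solvable.
Set Implicit Arguments.
Unset Strict Implicit.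
Unset Printing Implicit Defensive.
Import Order.TTheory GRing.Theory Num.Theory.

Record sgraph := SGraph {
  vertex :> finType;
  adj : rel vertex;
  adj_sym : symmetric adj;
  adj_irr : irreflexive adj
}.

Section Graphs.
Variable X : sgraph.

Definition deg (v : X) : nat := #|[set w | adj v w]|.

(* An edge is the two-element set of its endpoints, so that each undirected
   edge is counted once. *)
Definition edges : {set {set X}} :=
  [set [set uv.1; uv.2] | uv : X * X & adj uv.1 uv.2].

Definition zagreb1 : nat := \sum_(v : X) deg v ^ 2.

(* The product over the set e is deg u * deg v when e = {u, v}, u != v. *)
Definition zagreb2 : nat := \sum_(e in edges) \prod_(v in e) deg v.

Definition compl_adj : rel X := [rel u v | (u != v) && ~~ adj u v].

Lemma compl_adj_sym : symmetric compl_adj.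
Proof. by move=> u v; rewrite /compl_adj /= eq_sym adj_sym. Qed.

Lemma compl_adj_irr : irreflexive compl_adj.
Proof. by move=> u; rewrite /compl_adj /= eqxx. Qed.

Definition complement : sgraph := SGraph compl_adj_sym compl_adj_irr.

End Graphs.

Section CommutingGraph.
Variables (gT : finGroupType) (G : {group gT}).
Local Open Scope group_scope.

Definition noncentral : finType := {x : gT | x \in G :\: 'Z(G)}.

Definition commuting_adj : rel noncentral :=
  [rel x y | (x != y) && (val x * val y == val y * val x)].

Lemma commuting_adj_sym : symmetric commuting_adj.
Proof. by move=> x y; rewrite /commuting_adj /= eq_sym; congr (_ && _); rewrite eq_sym. Qed.

Lemma commuting_adj_irr : irreflexive commuting_adj.
Proof. by move=> x; rewrite /commuting_adj /= eqxx. Qed.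

Definition commuting_graph : sgraph :=
  SGraph commuting_adj_sym commuting_adj_irr.

Definition noncommuting_graph : sgraph := complement commuting_graph.

End CommutingGraph.

(* Main.v *)
Require Import Defs.
From mathcomp Require Import all_boot all_order all_fingroup all_algebra all_solvable.
From mathcomp Require Import ring lra.
Import Order.TTheory GRing.Theory Num.Theory.
Local Open Scope ring_scope.

(** A matrix commuting with a nonscalar 2x2 matrix A is a linear combination
of A and the identity, so commuting is an equivalence relation on noncentral
elements and the commuting graph is a disjoint union of cliques. If r is the
number of roots in F of the characteristic polynomial of A, the noncentral
elements commuting with A are the b (A - s) with b nonzero and s not a root,
so the clique of A has (q - 1)(q - r) elements. For a trace t and determinant
d whose polynomial has r roots there are q (q - 1) + q r matrices, and summing
over the pairs (t, d) gives the number of vertices with each r = 0, 1, 2. Both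
ratio inequalities are then instances of Chebyshev's sum inequality. *)

(** * Sums over edges and degrees in the complement *)

Section Handshake.
Local Open Scope nat_scope.
Variable X : sgraph.

Lemma eq_set2 (u v a b : X) :
  ([set a; b] == [set u; v]) = ((a, b) == (u, v)) || ((a, b) == (v, u)).
Proof.
rewrite !xpair_eqE; apply/eqP/idP => [/setP E|]; last first.
  by case/orP=> /andP[/eqP-> /eqP->] //; rewrite setUC.
move: (E a) (E b) (E u) (E v); rewrite !inE !eqxx !orbT ![u == _]eq_sym ![v == _]eq_sym.
by case: (a == u); case: (a == v); case: (b == u); case: (b == v).
Qed.

(** Each edge comes from exactly two ordered pairs of endpoints. Taking [f] constant 1 gives the
    handshake lemma, and [f] the degree gives the second Zagreb index. *)
Lemma sum_edges (f : X -> nat) :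
  2 * \sum_(e in edges X) \prod_(v in e) f v =
  \sum_u \sum_(v | adj u v) f u * f v.
Proof.
rewrite pair_big_dep /= big_distrr /=.
rewrite [RHS](partition_big (fun uv : X * X => [set uv.1; uv.2]) (mem (edges X))) /=;
  last by move=> uv uvP; apply/imsetP; exists uv; rewrite ?inE.
apply: eq_bigr => e /imsetP[[u v]]; rewrite inE /= => uv ->.
have neq_uv: u != v by apply: contraTneq uv => ->; rewrite adj_irr.
rewrite big_setU1 ?inE //= big_set1.
rewrite (bigD1 (u, v)) /=; last by rewrite uv eqxx.
rewrite (bigD1 (v, u)) /=; last first.
  by rewrite adj_sym uv setUC eqxx xpair_eqE (negbTE (contraNneq _ neq_uv)) // => ->.
rewrite big1 ?addn0 => [|[a b]]; first by rewrite mulnC [f v * _]mulnC muln2 addnn.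
by rewrite eq_set2 => /andP[/andP[/andP[_ /orP[]/eqP->]]]; rewrite eqxx // => _.
Qed.

Lemma sum_deg : 2 * #|edges X| = \sum_(u : X) deg u.
Proof.
rewrite -sum1_card (eq_bigr (fun e : {set X} => \prod_(v in e) 1)); last first.
  by move=> e _; rewrite big1.
rewrite sum_edges; apply: eq_bigr => u _.
by rewrite sum_nat_cond_const !muln1.
Qed.

Lemma deg_complement (u : X) : deg (u : complement X) + (deg u).+1 = #|X|.
Proof.
have -> : (deg u).+1 = #|u |: [set w | adj u w]|.
  by rewrite cardsU1 inE adj_irr add1n.
rewrite -[RHS](cardsC (u |: [set w | adj u w])) addnC; congr (_ + _).
by apply: eq_card => w; rewrite !inE /= /compl_adj /= negb_or eq_sym.
Qed.

End Handshake.

(** * The second Zagreb index when adjacent vertices have equal degrees *)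

Section RegularCliques.
Local Open Scope nat_scope.
Variable X : sgraph.
Hypothesis deg_adj : forall u v : X, adj u v -> deg u = deg v.

Lemma zagreb2_cliques : 2 * zagreb2 X = \sum_(u : X) deg u ^ 3.
Proof.
rewrite sum_edges; apply: eq_bigr => u _.
rewrite (eq_bigr (fun _ => deg u * deg u)) => [|v /deg_adj->] //.
by rewrite sum_nat_cond_const !expnS expn0 muln1.
Qed.

(** The right side expands over all ordered pairs. The pairs not adjacent in the complement join [u]
    to its closed neighbourhood in [X], of size [(deg u).+1], on which [d] is constant. Moving this
    part to the left avoids truncated subtraction. *)
Lemma zagreb2_complement_cliques (d := fun u => deg (u : complement X)) :
  2 * zagreb2 (complement X) + \sum_u d u ^ 2 * (deg (u : X)).+1
  = (\sum_u d u) ^ 2.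
Proof.
rewrite sum_edges expnS expn1 big_distrl -big_split /=.
apply: eq_bigr => u _; rewrite -big_distrr /= -mulnn -mulnA -mulnDr; congr (_ * _).
rewrite [RHS](bigID (fun v => compl_adj u v)) /=; congr (_ + _).
rewrite (eq_bigl (mem (u |: [set w | adj u w]))) => [|v]; last first.
  by rewrite !inE /= /compl_adj /= negb_and !negbK eq_sym.
rewrite (eq_bigr (fun _ => d u)) => [|v].
  by rewrite sum_nat_const cardsU1 inE adj_irr add1n mulnC.
rewrite !inE => /predU1P[-> //|/deg_adj uv].
by apply/eqP; rewrite -(eqn_add2r (deg u).+1) [in X in X == _]uv !deg_complement.
Qed.

End RegularCliques.

(** * Counting monic quadratics over a finite field by number of roots *)

Section Counting.
Variable F : finFieldType.
Implicit Types s t d : F.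

(** The polynomial is the characteristic polynomial for trace [t] and determinant [d]; a double root
    counts once. *)
Definition nroots t d := #|[set s : F | s ^+ 2 - t * s + d == 0]|.

Lemma sum_const_neq0 (c : rat) : \sum_(s : F | s != 0) c = (#|F|%:R - 1) * c.
Proof.
rewrite (cardD1 (0 : F)) inE natrD [1%:R + _]addrC addrK mulr_natl -sumr_const.
by apply: eq_bigl => s; rewrite !inE andbT.
Qed.

Lemma root_prodE s t d : (s ^+ 2 - t * s + d == 0) = (s * (t - s) == d).
Proof.
by rewrite [RHS]eq_sym -[RHS]subr_eq0; congr (_ == 0); ring.
Qed.

Lemma nroots_sum_prod s u : nroots (s + u) (s * u) = (s != u).+1.
Proof.
rewrite /nroots -[RHS]cards2; apply: eq_card => x; rewrite !inE.
by rewrite -!(subr_eq0 x) -mulf_eq0; congr (_ == 0); ring.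
Qed.

Lemma nroots_gt0 t d : (0 < nroots t d)%N -> exists s, d = s * (t - s).
Proof.
by case/card_gt0P => s; rewrite inE root_prodE => /eqP <-; exists s.
Qed.

(** A root [s] splits the quadratic, with [t - s] as the other root. *)
Lemma nroots_cases t d : [\/ nroots t d = 0, nroots t d = 1 | nroots t d = 2]%N.
Proof.
case: (posnP (nroots t d)) => [->|/nroots_gt0[s ->]]; first by constructor.
have := nroots_sum_prod s (t - s); rewrite subrKC => ->.
by case: (_ == _); [constructor 2 | constructor 3].
Qed.

(* Unfolding the weight [nroots t d] as a sum over the roots s of
   X^2 - t X + d turns the pairs (t, d) into pairs of roots (s, t - s). *)
Lemma sum_nroots (g : nat -> rat) :
  \sum_t \sum_(d | d != 0) (nroots t d)%:R * g (nroots t d)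
  = (#|F|%:R - 1) * g 1%N + (#|F|%:R - 1) * (#|F|%:R - 2) * g 2%N.
Proof.
have E t : \sum_(d | d != 0) (nroots t d)%:R * g (nroots t d)
   = \sum_(s | s * (t - s) != 0) g (s != t - s).+1.
  rewrite [RHS](partition_big (fun s => s * (t - s)) (fun d => d != 0)) //=.
  apply: eq_bigr => d d0; rewrite {1}/nroots -sum1_card natr_sum mulr_suml.
  apply: eq_big => [s|s].
    by rewrite inE root_prodE; case: eqP => [->|_]; rewrite ?d0 ?andbF.
  rewrite inE root_prodE mul1r => /eqP <-.
  by have := nroots_sum_prod s (t - s); rewrite subrKC => ->.
rewrite (eq_bigr _ (fun t _ => E t)) (exchange_big_dep predT) //=.
have Eu s : \sum_(t | s * (t - s) != 0) g (s != t - s).+1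
  = (s != 0)%:R * (g 1%N + (#|F|%:R - 2) * g 2%N).
  (* With [t = u + s] the second root [u] runs freely over the nonzero elements; [u = s] is the
     double root. *)
  rewrite (reindex (fun u => u + s)) /=; last first.
    by exists (fun u => u - s) => u _; rewrite ?addrK ?subrK.
  under eq_bigl do rewrite addrK mulf_eq0 negb_or.
  under eq_bigr do rewrite addrK.
  case: eqVneq => [_|s0]; first by rewrite big_pred0_eq mul0r.
  rewrite (bigD1 s) //= eqxx mul1r; congr (_ + _).
  rewrite (eq_bigr (fun _ => g 2%N)); last by move=> u /andP[_]; rewrite eq_sym => ->.
  rewrite sumr_const -[LHS]mulr_natl; congr (_ * _).
  have := cardC [set 0; s]; rewrite cards2 eq_sym s0 => <-; rewrite natrD addrAC subrr add0r.
  by congr _%:R; apply: eq_card => x; rewrite !inE negb_or.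
rewrite (eq_bigr _ (fun s _ => Eu s)) -mulr_suml.
rewrite -natr_sum -big_mkcond natr_sum sum_const_neq0 /=.
ring.
Qed.

Lemma sum_nroots_fun (h : nat -> rat) (q := #|F|%:R : rat) :
  \sum_t \sum_(d | d != 0) h (nroots t d)
  = q * (q - 1) / 2 * h 0%N + (q - 1) * h 1%N + (q - 1) * (q - 2) / 2 * h 2%N.
Proof.
(* The difference quotient [(h i - h 0) / i] for [i] equal to 1 or 2, so that [h i = h 0 + i * g i]
   and [sum_nroots] applies. *)
pose g i := if i == 1%N then h 1%N - h 0%N else (h 2%N - h 0%N) / 2.
have E t d : h (nroots t d) = h 0%N + (nroots t d)%:R * g (nroots t d).
  by case: (nroots_cases t d) => ->; rewrite /g /=; field.
under eq_bigr do under eq_bigr do rewrite E.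
under eq_bigr do rewrite big_split /=.
rewrite big_split /= sum_nroots /g /=.
under eq_bigr do rewrite sum_const_neq0.
by rewrite sumr_const -[_ *+ _]mulr_natl -/q; field.
Qed.

(** Each nonzero [b] determines [c], while [b = 0] leaves [c] free if [k = 0] and impossible
    otherwise. *)
Lemma card_mul_eq k (q := #|F|%:R : rat) :
  #|[set bc : F * F | bc.1 * bc.2 == k]|%:R = (q - 1) + (k == 0)%:R * q.
Proof.
have -> : #|[set bc : F * F | bc.1 * bc.2 == k]| = (\sum_b \sum_(c | (b * c)%R == k) 1)%N.
  by rewrite pair_big_dep /= sum1_card cardsE.
rewrite (bigD1 0) //= natrD addrC; congr (_ + _).
  rewrite (eq_bigr (fun _ => 1%N)) => [|b b0].
    by rewrite natr_sum sum_const_neq0 mulr1.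
  rewrite (eq_bigl (pred1 (b^-1 * k))) ?big_pred1_eq // => c /=.
  by rewrite -(inj_eq (mulfI (invr_neq0 b0))) mulKf.
under eq_bigl do rewrite mul0r eq_sym.
by case: eqP; rewrite ?big_pred0_eq ?mul0r // mul1r sum1_card.
Qed.

End Counting.

(** * Commutation and counting of 2x2 matrices *)

Section Matrices2.
Variable F : finFieldType.
Implicit Types A B : 'M[F]_2.

Lemma mx2_eq A B :
  A 0 0 = B 0 0 -> A 0 1 = B 0 1 -> A 1 0 = B 1 0 -> A 1 1 = B 1 1 -> A = B.
Proof.
move=> e00 e01 e10 e11; apply/matrixP=> i j.
have ord2 (k : 'I_2) : k = 0 \/ k = 1.
  by case: k => [[|[|//]] ?]; [left | right]; apply: val_inj.
by case: (ord2 i) (ord2 j) => [] -> [] ->.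
Qed.

Lemma det_mx2 A : \det A = A 0 0 * A 1 1 - A 0 1 * A 1 0.
Proof.
rewrite (expand_det_row _ 0) !big_ord_recl big_ord0 /cofactor !det_mx11 !mxE /=.
have -> : lift 0 0 = 1 :> 'I_2 by apply: val_inj.
have -> : lift 1 0 = 0 :> 'I_2 by apply: val_inj.
by rewrite expr0 expr1; ring.
Qed.

Lemma tr_mx2 A : \tr A = A 0 0 + A 1 1.
Proof. by rewrite /mxtrace !big_ord_recl big_ord0 addr0; congr (_ + A _ _); apply: val_inj. Qed.

Lemma mulmx2E A B i j : (A *m B) i j = A i 0 * B 0 j + A i 1 * B 1 j.
Proof.
rewrite mxE !big_ord_recl big_ord0 addr0.
by have -> : lift ord0 ord0 = 1 :> 'I_2 by apply: val_inj.
Qed.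

Lemma is_scalar_mx2E A :
  is_scalar_mx A = [&& A 0 1 == 0, A 1 0 == 0 & A 0 0 == A 1 1].
Proof.
apply/is_scalar_mxP/and3P => [[a ->]|[/eqP e01 /eqP e10 /eqP e]]; rewrite ?mxE //.
by exists (A 0 0); apply: mx2_eq; rewrite !mxE.
Qed.

(** The second factor is the characteristic polynomial at [s], which decides when [b (A - s)] is
    invertible. *)
Lemma det_scale_sub_scalar A b s :
  \det (b *: (A - s%:M)) = b ^+ 2 * (s ^+ 2 - \tr A * s + \det A).
Proof. by rewrite !det_mx2 tr_mx2 !mxE /=; ring. Qed.

Lemma is_scalar_scale_sub A b s : ~~ is_scalar_mx A ->
  is_scalar_mx (b *: (A - s%:M)) = (b == 0).
Proof.
move=> nsA; apply/idP/eqP => [|->]; last by rewrite scale0r mx0_is_scalar.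
move=> /is_scalar_mxP[c E]; apply: contraNeq nsA => b0.
apply/is_scalar_mxP; exists (b^-1 * c + s).
by rewrite raddfD /= -scale_scalar_mx -E scalerA mulVf // scale1r subrK.
Qed.

Lemma comm_mx2_nonscalar A B : ~~ is_scalar_mx A -> ~~ is_scalar_mx B ->
  A *m B = B *m A -> exists b s, b != 0 /\ B = b *: (A - s%:M).
Proof.
move=> nsA nsB AB.
suff [b [a E]] : exists b a, B = b *: A + a%:M.
  have b0 : b != 0.
    apply: contraNneq nsB => b0; rewrite E b0 scale0r add0r.
    exact: scalar_mx_is_scalar.
  exists b, (- b^-1 * a); split=> //.
  by rewrite E scalerBr scale_scalar_mx mulNr mulrN mulVKf // raddfN opprK.
have E i j : (A *m B) i j = (B *m A) i j by rewrite AB.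
move: (E 0 0) (E 0 1) (E 1 0); rewrite !mulmx2E => {E} e00 e01 e10.
(* Each remaining entry of [B = b A + a], multiplied by a nonzero pivot [k], becomes an entry of
   [A B = B A]. The pivot is whichever of [A 0 1], [A 1 0], [A 0 0 - A 1 1] is nonzero; it fixes [b]
   as a ratio of entries, and entry (0, 0) then fixes [a]. *)
have cross (k x y u v : F) : k != 0 -> u = v -> k * x - k * y = u - v -> x = y.
  by move=> k0 -> /eqP; rewrite subrr subr_eq0 => /eqP/(mulfI k0).
move: nsA; rewrite is_scalar_mx2E !negb_and => /or3P[] n0.
- exists (B 0 1 / A 0 1), (B 0 0 - B 0 1 / A 0 1 * A 0 0).
  apply: mx2_eq; rewrite !mxE /= ?mulr1n ?mulr0n.
  + by ring.
  + by rewrite addr0 mulfVK.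
  + by apply: (cross _ _ _ _ _ n0 e00); field.
  + by apply: (cross _ _ _ _ _ n0 e01); field.
- exists (B 1 0 / A 1 0), (B 0 0 - B 1 0 / A 1 0 * A 0 0).
  apply: mx2_eq; rewrite !mxE /= ?mulr1n ?mulr0n.
  + by ring.
  + by apply: (cross _ _ _ _ _ n0 (esym e00)); field.
  + by rewrite addr0 mulfVK.
  + by apply: (cross _ _ _ _ _ n0 (esym e10)); field.
- rewrite -subr_eq0 in n0.
  exists ((B 0 0 - B 1 1) / (A 0 0 - A 1 1)),
    (B 0 0 - (B 0 0 - B 1 1) / (A 0 0 - A 1 1) * A 0 0).
  apply: mx2_eq; rewrite !mxE /= ?mulr1n ?mulr0n.
  + by ring.
  + by apply: (cross _ _ _ _ _ n0 e01); field.
  + by apply: (cross _ _ _ _ _ n0 (esym e10)); field.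
  + by field.
Qed.

Definition mx2 (a b c d : F) : 'M[F]_2 :=
  \matrix_(i, j) if i == 0 then if j == 0 then a else b else if j == 0 then c else d.

(** The entry [a] and the trace fix the diagonal, leaving [b c = a (t - a) - d]. The right side
    vanishes exactly when [a] is a root, and each root contributes an extra [q]. *)
Lemma card_tr_det t d (q := #|F|%:R : rat) :
  #|[set A : 'M[F]_2 | (\tr A == t) && (\det A == d)]|%:R
  = q * (q - 1) + q * (nroots F t d)%:R.
Proof.
have -> : #|[set A : 'M[F]_2 | (\tr A == t) && (\det A == d)]|
  = (\sum_(a : F) #|[set bc : F * F | (bc.1 * bc.2 == a * (t - a) - d)%R]|)%N.
  rewrite -sum1_card.
  under [RHS]eq_bigr do rewrite -sum1_card.
  rewrite pair_big_dep /=.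
  rewrite (reindex_onto (fun x : F * (F * F) => mx2 x.1 x.2.1 x.2.2 (t - x.1))
     (fun A => (A 0 0, (A 0 1, A 1 0)))) /=; last first.
    move=> A; rewrite inE => /andP[/eqP <- _].
    by apply: mx2_eq; rewrite !mxE //= tr_mx2 addrC addKr.
  apply: eq_bigl => -[a [b c]]; rewrite !inE /= !mxE /= eqxx andbT.
  rewrite tr_mx2 det_mx2 !mxE /= subrKC eqxx /=.
  by rewrite -[LHS]subr_eq0 -[RHS]subr_eq0 -[LHS]oppr_eq0; congr (_ == 0); ring.
rewrite natr_sum; under eq_bigr do rewrite card_mul_eq.
rewrite big_split /= sumr_const -[_ *+ _]mulr_natl -mulr_suml -natr_sum; congr (_ + _).
rewrite mulrC; congr (_ * _%:R).
rewrite /nroots -sum1_card [RHS]big_mkcond; apply: eq_bigr => s _.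
by rewrite inE root_prodE subr_eq0; case: (_ == _).
Qed.

(* [card_tr_det] counts all invertible matrices with a given trace and
   determinant; the scalar ones, each with a double root, are subtracted. *)
Lemma sum_nonscalar (h : nat -> rat) (q := #|F|%:R : rat) :
  \sum_(A : 'M[F]_2 | (A \in unitmx) && ~~ is_scalar_mx A) h (nroots F (\tr A) (\det A))
  = q ^+ 2 * (q - 1) ^+ 2 / 2 * h 0%N + (q - 1) ^+ 2 * (q + 1) * h 1%N
    + q * (q + 1) * (q - 1) * (q - 2) / 2 * h 2%N.
Proof.
have all_units : \sum_(A : 'M[F]_2 | A \in unitmx) h (nroots F (\tr A) (\det A))
  = \sum_t \sum_(d | d != 0) (q * (q - 1) + q * (nroots F t d)%:R) * h (nroots F t d).
  rewrite pair_big_dep /=.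
  rewrite (partition_big (fun A => (\tr A, \det A)) (fun td => td.2 != 0)) /= => [|A].
    apply: eq_bigr => -[t d] /= d0; rewrite -card_tr_det -sum1_card natr_sum mulr_suml.
    apply: eq_big => [A|A]; rewrite ?inE xpair_eqE.
      by rewrite unitmxE unitfE; case: (\det A =P d) => [->|]; rewrite ?d0 ?andbF.
    by case/andP=> _ /andP[/eqP-> /eqP->]; rewrite mul1r.
  by rewrite unitmxE unitfE.
have scalars : \sum_(A : 'M[F]_2 | (A \in unitmx) && is_scalar_mx A) h (nroots F (\tr A) (\det A))
  = (q - 1) * h 1%N.
  rewrite -sum_const_neq0 (reindex_onto (fun s : F => s%:M : 'M[F]_2) (fun A => A 0 0)) /=.
    apply: eq_big => [s|s _].
      rewrite unitmxE unitfE scalar_mx_is_scalar det_scalar mxE eqxx andbT expf_eq0 /=.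
      by rewrite eqxx andbT.
    by rewrite mxtrace_scalar det_scalar mulr2n expr2 nroots_sum_prod eqxx.
  by move=> A /andP[_ /is_scalar_mxP[s ->]]; rewrite mxE.
move: all_units; rewrite (bigID (fun A => is_scalar_mx A)) /= scalars.
move/(canRL (addKr _)) ->.
by rewrite (sum_nroots_fun F (fun r => (q * (q - 1) + q * r%:R) * h r)) -/q; field.
Qed.

(** The pairs [(b, s)] with [b] nonzero and [s] not a root parametrize these matrices bijectively by
    [b (A - s)]. *)
Lemma card_comm_nonscalar A (q := #|F|%:R : rat) : ~~ is_scalar_mx A ->
  #|[set B : 'M[F]_2 | [&& B \in unitmx, ~~ is_scalar_mx B & A *m B == B *m A]]|%:R
  = (q - 1) * (q - (nroots F (\tr A) (\det A))%:R).
Proof.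
move=> nsA.
pose Rt := [set s : F | s ^+ 2 - \tr A * s + \det A == 0].
pose f (bs : F * F) := bs.1 *: (A - bs.2%:M).
have -> : [set B : 'M[F]_2 | [&& B \in unitmx, ~~ is_scalar_mx B & A *m B == B *m A]]
  = f @: setX [set~ 0] (~: Rt).
  apply/setP => B; rewrite inE; apply/and3P/imsetP => [[uB nsB /eqP AB]|[[b s]]].
    have [b [s [b0 E]]] := comm_mx2_nonscalar A B nsA nsB AB.
    exists (b, s); rewrite // !inE /= b0 /=.
    by move: uB; rewrite E unitmxE unitfE det_scale_sub_scalar mulf_eq0 negb_or => /andP[].
  rewrite !inE /= => /andP[b0 s0] ->; rewrite /f /= unitmxE unitfE det_scale_sub_scalar.
  rewrite mulf_neq0 ?expf_neq0 // is_scalar_scale_sub // b0; split=> //.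
  by rewrite -scalemxAr -scalemxAl mulmxBr mulmxBl mul_mx_scalar mul_scalar_mx.
rewrite card_in_imset => [|[b s] [c u]].
  rewrite cardsX natrM; congr (_ * _).
    rewrite cardsC1 -subn1 natrB //.
    by apply/card_gt0P; exists 0.
  by rewrite /q -(cardsC Rt) natrD addrC addKr.
rewrite !inE /= => /andP[b0 _] /andP[c0 _]; rewrite /f /= => E.
suff bc : b = c.
  move: E; rewrite -bc => /(scalerI b0)/addrI/oppr_inj E.
  by congr (_, _); have := congr1 (fun M : 'M_2 => M 0 0) E; rewrite !mxE.
(* If [b] and [c] differ, [b (A - s) = c (A - u)] can be solved for [A], giving a scalar. *)
apply: contraNeq nsA; rewrite -subr_eq0 => bc.
apply/is_scalar_mxP; exists ((b - c)^-1 * (b * s - c * u)).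
rewrite -scale_scalar_mx raddfB /= -!scale_scalar_mx.
apply: (canRL (scalerK bc)); apply/eqP; move/eqP: E.
by rewrite scalerBl !scalerBr !subr_eq addrAC [c *: A + _]addrC [in X in _ -> X]addrAC.
Qed.

End Matrices2.

(** * The commuting graph of GL(2, q): center, cliques and degrees *)

Section GL2.
Variable F : finFieldType.
Implicit Types (u : {'GL_2[F]}) (A : 'M[F]_2).
Local Notation q := (#|F|%:R : rat).
Local Notation X := (commuting_graph 'GL_2[F]%G).
Definition mat (x : X) : 'M[F]_2 := GLval (val x).

Lemma GL_unitmx2 u : (GLval u : 'M[F]_2) \in unitmx.
Proof. by rewrite unitmxE unitfE; exact: (GL_det u). Qed.

Lemma mem_center_GL2 u : (u \in 'Z('GL_2[F])%g) = is_scalar_mx (GLval u : 'M[F]_2).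
Proof.
apply/centerP/idP => [[_ cu]|/is_scalar_mxP[a E]].
  have comm A : A \in unitmx -> (GLval u : 'M_2) *m A = A *m GLval u.
    by move=> uA; have := congr1 GLval (cu (FinRing.Unit uA) (in_setT _)).
  (* Commuting with the upper and lower elementary transvections already forces zero off-diagonal
     entries and equal diagonal entries. *)
  have U1 b c : b * c = 0 -> mx2 F 1 b c 1 \in unitmx.
    by move=> bc; rewrite unitmxE unitfE det_mx2 !mxE /= bc mulr1 subr0 oner_eq0.
  have /matrixP e1 := comm _ (U1 1 0 (mulr0 _)).
  have /matrixP e2 := comm _ (U1 0 1 (mul0r _)).
  have diff0 (x y z : F) : y = z -> z - y = x -> x == 0.
    by move=> -> <-; rewrite subrr.
  move: (e1 0 0) (e1 0 1) (e2 0 0); rewrite !mulmx2E !mxE /= => {e1 e2} e10 e11 e01.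
  rewrite is_scalar_mx2E; apply/and3P; split.
  - by apply: (diff0 _ _ _ (esym e01)); ring.
  - by apply: (diff0 _ _ _ e10); ring.
  - by rewrite -subr_eq0; apply: (diff0 _ _ _ (esym e11)); ring.
split=> [|v _]; first exact: in_setT.
apply: val_inj; change (GLval u *m GLval v = GLval v *m (GLval u : 'M_2)).
by rewrite E scalar_mxC.
Qed.

Lemma noncentral_nonscalar (x : X) : ~~ is_scalar_mx (mat x).
Proof. by have := valP x; rewrite inE mem_center_GL2 => /andP[]. Qed.

Lemma adj_GL2 (x y : X) : adj x y = (x != y) && (mat x *m mat y == mat y *m mat x).
Proof. by congr (_ && _). Qed.

Lemma sum_noncentral (P : pred 'M[F]_2) (h : 'M[F]_2 -> rat) :
  \sum_(x : X | P (mat x)) h (mat x) =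
  \sum_(A : 'M[F]_2 | [&& A \in unitmx, ~~ is_scalar_mx A & P A]) h A.
Proof.
rewrite -(big_sub_cond (mem ('GL_2[F] :\: 'Z('GL_2[F]))%g)
  (fun u => P (GLval u)) (fun u => h (GLval u))).
rewrite (reindex_omap (GLval : {'GL_2[F]} -> 'M[F]_2) insub) /=.
  apply: eq_bigl => u; rewrite [u \in _]in_setD mem_center_GL2 in_setT.
  by rewrite valK eqxx !andbT GL_unitmx2.
by move=> A /andP[uA _]; rewrite insubT.
Qed.

(** Since [B = b (A - s)] with [b] nonzero, [A] and [B] have the same centralizer. *)
Lemma comm_nonscalar_trans (A B C : 'M[F]_2) :
  ~~ is_scalar_mx A -> ~~ is_scalar_mx B -> A *m B = B *m A ->
  (A *m C == C *m A) = (B *m C == C *m B).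
Proof.
move=> nsA nsB AB; have [b [s [b0 ->]]] := comm_mx2_nonscalar _ A B nsA nsB AB.
rewrite -scalemxAr -scalemxAl (inj_eq (scalerI b0)) mulmxBl mulmxBr scalar_mxC.
by rewrite (inj_eq (addIr _)).
Qed.

Lemma deg_commuting_card (x : X) :
  (deg x).+1 = #|[set y : X | mat x *m mat y == mat y *m mat x]|.
Proof.
have -> : [set y : X | mat x *m mat y == mat y *m mat x] = x |: [set y | adj x y].
  by apply/setP => y; rewrite !inE adj_GL2; case: (eqVneq y x) => [->|_] //=; apply/eqP.
by rewrite cardsU1 inE adj_irr add1n.
Qed.

Lemma deg_commuting_adj (x y : X) : adj x y -> deg x = deg y.
Proof.
rewrite adj_GL2 => /andP[_ /eqP xy]; apply: succn_inj.
have Ex := deg_commuting_card x; have Ey := deg_commuting_card y.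
apply: etrans Ex _; apply: etrans (esym Ey); apply: eq_card => z; rewrite !inE.
exact: comm_nonscalar_trans (noncentral_nonscalar x) (noncentral_nonscalar y) xy.
Qed.

(** The final [- 1] removes [x] itself from its clique. *)
Lemma deg_commutingE (x : X) :
  (deg x)%:R = (q - 1) * (q - (nroots F (\tr (mat x)) (\det (mat x)))%:R) - 1.
Proof.
rewrite -(card_comm_nonscalar _ (mat x) (noncentral_nonscalar x)).
apply: (canRL (addrK 1)); rewrite -mulrSr deg_commuting_card -!sum1_card !natr_sum.
under eq_bigl do rewrite inE; under [RHS]eq_bigl do rewrite inE.
exact: (sum_noncentral (fun B => mat x *m B == B *m mat x) (fun=> 1)).
Qed.

Lemma sum_noncentral_nroots (h : nat -> rat) :
  \sum_(x : X) h (nroots F (\tr (mat x)) (\det (mat x)))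
  = q ^+ 2 * (q - 1) ^+ 2 / 2 * h 0%N + (q - 1) ^+ 2 * (q + 1) * h 1%N
    + q * (q + 1) * (q - 1) * (q - 2) / 2 * h 2%N.
Proof.
rewrite (sum_noncentral predT (fun A => h (nroots F (\tr A) (\det A)))).
by under eq_bigl do rewrite andbT; rewrite sum_nonscalar.
Qed.

End GL2.

(** * Inequalities behind the ratio comparison *)

Lemma ratio_lt (M1 M2 E N : rat) : 0 < E -> 0 < N ->
  M1 * (2 * E) < 2 * M2 * N -> M1 / N < M2 / E.
Proof.
by move=> E0 N0 H; rewrite ltr_pdivrMr // mulrAC ltr_pdivlMr //; lra.
Qed.

(* Chebyshev's sum inequality: the difference of the two sides is the sum over
   i < j of n_i n_j (d_i + d_j - c) (d_i - d_j)^2. The case c = 0 is for the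
   cliques, c = N for their complement on N vertices. *)
Lemma chebyshev_three_classes (n0 n1 n2 d0 d1 d2 c : rat) :
  0 < n0 -> 0 < n1 -> 0 < n2 -> d0 != d1 ->
  c < d0 + d1 -> c < d0 + d2 -> c < d1 + d2 ->
  (n0 * d0 ^+ 2 + n1 * d1 ^+ 2 + n2 * d2 ^+ 2) * (n0 * d0 + n1 * d1 + n2 * d2)
  < (n0 * d0 ^+ 2 * (d0 - c) + n1 * d1 ^+ 2 * (d1 - c) + n2 * d2 ^+ 2 * (d2 - c))
      * (n0 + n1 + n2) + c * (n0 * d0 + n1 * d1 + n2 * d2) ^+ 2.
Proof.
move=> n0P n1P n2P d01 c01 c02 c12; rewrite -subr_gt0.
have -> : (n0 * d0 ^+ 2 * (d0 - c) + n1 * d1 ^+ 2 * (d1 - c) + n2 * d2 ^+ 2 * (d2 - c))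
      * (n0 + n1 + n2) + c * (n0 * d0 + n1 * d1 + n2 * d2) ^+ 2
    - (n0 * d0 ^+ 2 + n1 * d1 ^+ 2 + n2 * d2 ^+ 2) * (n0 * d0 + n1 * d1 + n2 * d2)
  = n0 * n1 * (d0 + d1 - c) * (d0 - d1) ^+ 2 + n0 * n2 * (d0 + d2 - c) * (d0 - d2) ^+ 2
    + n1 * n2 * (d1 + d2 - c) * (d1 - d2) ^+ 2 by ring.
(* The (0, 1) term supplies strictness; the other two are only bounded below by zero. *)
have d01' : 0 < (d0 - d1) ^+ 2 by rewrite exprn_even_gt0 //= subr_eq0.
rewrite -subr_gt0 in c01; rewrite -subr_gt0 in c02; rewrite -subr_gt0 in c12.
have term_ge0 (x y z t : rat) : 0 < x -> 0 < y -> 0 < z -> 0 <= x * y * z * t ^+ 2.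
  by move=> xP yP zP; rewrite mulr_ge0 ?sqr_ge0 ?ltW // !mulr_gt0.
rewrite -addrA; apply: ltr_wpDr; first by rewrite addr_ge0 ?term_ge0.
by rewrite mulr_gt0 // !mulr_gt0.
Qed.

(** Carries a Chebyshev inequality over to the Zagreb sums through an identity that [ring] can
    check. *)
Lemma lt_subr_eq (x y z t : rat) : x < y -> t - z = y - x -> z < t.
Proof. by rewrite -(subr_gt0 x) -(subr_gt0 z) => + ->. Qed.

(** * Zagreb indices of a union of cliques of three types *)

Section ThreeCliqueSizes.
(** A vertex of type [i] lies in a clique of [m i] vertices, itself included; [n0], [n1], [n2] are
    the numbers of vertices of each type. *)
Variables (X : sgraph) (r : X -> nat) (m : nat -> rat) (n0 n1 n2 : rat).
Hypothesis deg_adj : forall u v : X, adj u v -> deg u = deg v.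
Hypothesis degE : forall u : X, (deg u)%:R = m (r u) - 1.
Hypothesis sum_r : forall h : nat -> rat,
  \sum_u h (r u) = n0 * h 0%N + n1 * h 1%N + n2 * h 2%N.
Let N : rat := n0 + n1 + n2.

Lemma card_cliques : #|X|%:R = N.
Proof. by rewrite -sum1_card natr_sum (sum_r (fun=> 1)) !mulr1. Qed.

Lemma deg_complementE (u : X) : (deg (u : complement X))%:R = N - m (r u).
Proof. by rewrite -card_cliques -(deg_complement X u) natrD mulrSr degE subrK addrK. Qed.

Lemma zagreb1_cliquesE : (zagreb1 X)%:R =
  n0 * (m 0%N - 1) ^+ 2 + n1 * (m 1%N - 1) ^+ 2 + n2 * (m 2%N - 1) ^+ 2.
Proof.
rewrite natr_sum -(sum_r (fun i => (m i - 1) ^+ 2)).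
by apply: eq_bigr => u _; rewrite natrX degE.
Qed.

Lemma zagreb2_cliquesE : 2 * (zagreb2 X)%:R =
  n0 * (m 0%N - 1) ^+ 3 + n1 * (m 1%N - 1) ^+ 3 + n2 * (m 2%N - 1) ^+ 3.
Proof.
rewrite -natrM (zagreb2_cliques X deg_adj) natr_sum.
rewrite -(sum_r (fun i => (m i - 1) ^+ 3)).
by apply: eq_bigr => u _; rewrite natrX degE.
Qed.

Lemma edges_cliquesE : 2 * #|edges X|%:R =
  n0 * (m 0%N - 1) + n1 * (m 1%N - 1) + n2 * (m 2%N - 1).
Proof.
rewrite -natrM sum_deg natr_sum -(sum_r (fun i => m i - 1)).
by apply: eq_bigr => u _; rewrite degE.
Qed.

Lemma zagreb1_complementE : (zagreb1 (complement X))%:R =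
  n0 * (N - m 0%N) ^+ 2 + n1 * (N - m 1%N) ^+ 2 + n2 * (N - m 2%N) ^+ 2.
Proof.
rewrite natr_sum -(sum_r (fun i => (N - m i) ^+ 2)).
by apply: eq_bigr => u _; rewrite natrX deg_complementE.
Qed.

Lemma edges_complementE : 2 * #|edges (complement X)|%:R =
  n0 * (N - m 0%N) + n1 * (N - m 1%N) + n2 * (N - m 2%N).
Proof.
rewrite -natrM sum_deg natr_sum -(sum_r (fun i => N - m i)).
by apply: eq_bigr => u _; rewrite deg_complementE.
Qed.

Lemma zagreb2_complementE : 2 * (zagreb2 (complement X))%:R =
  (n0 * (N - m 0%N) + n1 * (N - m 1%N) + n2 * (N - m 2%N)) ^+ 2
  - (n0 * ((N - m 0%N) ^+ 2 * m 0%N) + n1 * ((N - m 1%N) ^+ 2 * m 1%N)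
     + n2 * ((N - m 2%N) ^+ 2 * m 2%N)).
Proof.
rewrite -edges_complementE -(sum_r (fun i => (N - m i) ^+ 2 * m i)).
apply: (canRL (addrK _)); rewrite -!natrM sum_deg -natrX.
rewrite -(zagreb2_complement_cliques X deg_adj) natrD natrM; congr (_ + _).
rewrite natr_sum; apply: eq_bigr => u _.
by rewrite natrM natrX deg_complementE mulrSr degE subrK.
Qed.

Hypotheses (n0_gt0 : 0 < n0) (n1_gt0 : 0 < n1) (n2_gt0 : 0 < n2).
Hypothesis m01 : m 0%N != m 1%N.

Lemma N_gt0 : 0 < N. Proof. by rewrite !addr_gt0. Qed.

Lemma zagreb_ratio_cliques : 1 < m 0%N -> 1 < m 1%N -> 1 < m 2%N ->
  (zagreb1 X)%:R / #|X|%:R < (zagreb2 X)%:R / #|edges X|%:R :> rat.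
Proof.
move=> m0 m1 m2; rewrite -subr_gt0 in m0; rewrite -subr_gt0 in m1; rewrite -subr_gt0 in m2.
apply: ratio_lt.
- by rewrite -(pmulr_rgt0 _ (ltr0n rat 2)) edges_cliquesE !addr_gt0 ?mulr_gt0.
- by rewrite card_cliques N_gt0.
rewrite zagreb1_cliquesE zagreb2_cliquesE edges_cliquesE card_cliques.
have ne : m 0%N - 1 != m 1%N - 1 by rewrite (inj_eq (addIr _)).
have H := chebyshev_three_classes n0 n1 n2 _ _ (m 2%N - 1) 0 n0_gt0 n1_gt0 n2_gt0 ne
  (addr_gt0 m0 m1) (addr_gt0 m0 m2) (addr_gt0 m1 m2).
by apply: (lt_subr_eq _ _ _ _ H); rewrite /N; ring.
Qed.

(** Chebyshev with [d_i = N - m i] and [c = N]: the condition [c < d_i + d_j] becomes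
    [m i + m j < N], and [d_i - c = - m i] yields the subtracted sum in [zagreb2_complementE]. *)
Lemma zagreb_ratio_complement :
  m 0%N + m 1%N < N -> m 0%N + m 2%N < N -> m 1%N + m 2%N < N ->
  0 < m 0%N -> 0 < m 1%N -> 0 < m 2%N ->
  (zagreb1 (complement X))%:R / #|complement X|%:R
  < (zagreb2 (complement X))%:R / #|edges (complement X)|%:R :> rat.
Proof.
move=> m01N m02N m12N m0 m1 m2.
have [N0 N1 N2] : [/\ 0 < N - m 0%N, 0 < N - m 1%N & 0 < N - m 2%N] by split; lra.
apply: ratio_lt.
- by rewrite -(pmulr_rgt0 _ (ltr0n rat 2)) edges_complementE !addr_gt0 ?mulr_gt0.
- by rewrite card_cliques N_gt0.
rewrite zagreb1_complementE zagreb2_complementE edges_complementE card_cliques.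
have ne : N - m 0%N != N - m 1%N by rewrite (inj_eq (addrI _)) (inj_eq oppr_inj).
have cN (x y : rat) : x + y < N -> N < N - x + (N - y) by move=> *; lra.
have H := chebyshev_three_classes _ _ _ _ _ _ N n0_gt0 n1_gt0 n2_gt0 ne
  (cN _ _ m01N) (cN _ _ m02N) (cN _ _ m12N).
by apply: (lt_subr_eq _ _ _ _ H); rewrite /N; ring.
Qed.

End ThreeCliqueSizes.

(** * Evaluation of the formulas and inequalities for GL(2, q) *)

Theorem theorem2p17 (p n : nat) (F : finFieldType)
    (p_prime : prime p) (n_ge1 : (1 <= n)%N) (q_gt2 : (2 < p ^ n)%N)
    (cardF : #|F| = (p ^ n)%N) :
  let q : rat := (p ^ n)%N%:R in
  let C := commuting_graph 'GL_2[F]%G in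
  let NC := noncommuting_graph 'GL_2[F]%G in
  [/\ (zagreb1 C)%:R =
        q * (q - 1) * (q ^+ 6 - 4 * q ^+ 5 + 4 * q ^+ 4 + 2 * q ^+ 3
                       - 4 * q ^+ 2 + q - 1),
      (zagreb2 C)%:R =
        q * (q - 1) / 2 *
        (q ^+ 8 - 6 * q ^+ 7 + 14 * q ^+ 6 - 15 * q ^+ 5 + 3 * q ^+ 4
         + 12 * q ^+ 3 - 16 * q ^+ 2 + 9 * q - 1),
      (zagreb1 NC)%:R =
        (q - 1) *
        (q ^+ 11 - 2 * q ^+ 10 - 4 * q ^+ 9 + 9 * q ^+ 8 + 5 * q ^+ 7
         - 15 * q ^+ 6 + q ^+ 5 + 7 * q ^+ 4 - 2 * q ^+ 3 + q ^+ 2 - q),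
      (zagreb2 NC)%:R =
        q * (q - 1) / 2 *
        (q ^+ 14 - 3 * q ^+ 13 - 4 * q ^+ 12 + 19 * q ^+ 11 - 47 * q ^+ 9
         + 28 * q ^+ 8 + 43 * q ^+ 7 - 50 * q ^+ 6 + 11 * q ^+ 5
         + 4 * q ^+ 4 - 12 * q ^+ 3 + 19 * q ^+ 2 - 11 * q + 2)
    & (zagreb2 C)%:R / #|edges C|%:R > (zagreb1 C)%:R / #|C|%:R :> rat /\
      (zagreb2 NC)%:R / #|edges NC|%:R > (zagreb1 NC)%:R / #|NC|%:R :> rat].
Proof.
rewrite -cardF => q C NC.
have q3 : 3 <= q by rewrite (ler_nat _ 3) cardF.
pose r (x : C) := nroots F (\tr (mat F x)) (\det (mat F x)).
pose m i : rat := (q - 1) * (q - i%:R).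
pose n0 := q ^+ 2 * (q - 1) ^+ 2 / 2.
pose n1 := (q - 1) ^+ 2 * (q + 1).
pose n2 := q * (q + 1) * (q - 1) * (q - 2) / 2.
have sum_r (h : nat -> rat) : \sum_(x : C) h (r x) = n0 * h 0%N + n1 * h 1%N + n2 * h 2%N.
  exact: sum_noncentral_nroots.
have degE (x : C) : (deg x)%:R = m (r x) - 1 by exact: deg_commutingE.
have deg_adj : forall x y : C, adj x y -> deg x = deg y by exact: deg_commuting_adj.
have M2 := zagreb2_cliquesE C r m _ _ _ deg_adj degE sum_r.
have M2' := zagreb2_complementE C r m _ _ _ deg_adj degE sum_r.
have half (x y : rat) : 2 * x = y -> x = y / 2 by move=> <-; field.
(* This is the order [(q^2 - 1)(q^2 - q)] of the group minus the [q - 1] scalars. *)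
have NE : n0 + n1 + n2 = (q - 1) * (q ^+ 3 - q - 1) by rewrite /n0 /n1 /n2; field.
split.
- by rewrite (zagreb1_cliquesE C r m _ _ _ degE sum_r) /n0 /n1 /n2 /m; field.
- by rewrite (half _ _ M2) /n0 /n1 /n2 /m; field.
- by rewrite (zagreb1_complementE C r m _ _ _ degE sum_r) NE /n0 /n1 /n2 /m; field.
- by rewrite (half _ _ M2') NE /n0 /n1 /n2 /m; field.
have q0 : 0 < q by lra.
have q1 : 0 < q - 1 by lra.
have n0_gt0 : 0 < n0 by rewrite /n0 !mulr_gt0 ?invr_gt0 ?exprn_gt0 //.
have n1_gt0 : 0 < n1 by rewrite /n1 !mulr_gt0 ?exprn_gt0 //; lra.
(* The factor [q - 2] is positive because [q] is at least 3. *)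
have n2_gt0 : 0 < n2 by rewrite /n2 !mulr_gt0 ?invr_gt0 //; lra.
have m01 : m 0%N != m 1%N by rewrite (inj_eq (mulfI _)) ?gt_eqF //; lra.
have m_gt1 i : (i <= 2)%N -> 1 < m i.
  move=> i2; have : i%:R <= 2 :> rat by rewrite ler_nat.
  by rewrite /m; nra.
(* After division by [q - 1] it suffices that [2 q < q^3 - q - 1], which follows from
   [9 q <= q^3]. *)
have m_lt i j : m i + m j < n0 + n1 + n2.
  rewrite NE /m -mulrDr ltr_pM2l //.
  have iP : 0 <= i%:R :> rat by [].
  have jP : 0 <= j%:R :> rat by [].
  have : 9 * q <= q ^+ 3 by rewrite exprSr ler_pM2r //; nra.
  lra.
split.
  by apply: (zagreb_ratio_cliques C r m _ _ _ deg_adj degE sum_r) => //; exact: m_gt1.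
by apply: (zagreb_ratio_complement C r m _ _ _ deg_adj degE sum_r) => //;
  apply: lt_trans ltr01 _; exact: m_gt1.
Qed.
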